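(* Let $d\ge1$, let $\bm F:\mathbb R\to\mathbb R^d$ be globally Lipschitz continuous with $\bm F(0)=\bm 0$, let $w$ be a non-negative Radon measure on $S^{d-1}$ satisfying $\int_{S^{d-1}}(\bm n_\theta\cdot\bm e_i)(\bm n_\theta\cdot\bm e_j)\,dw(\theta)=\delta_{ij}$ for $i,j=1,\dots,d$, and let $\Phi$ be a non-negative, non-increasing function on $(0,\infty)$ with $\Phi(0)<\infty$. Let $u_0\in L^\infty(\mathbb R^d)$ be Lipschitz continuous and let $u$ be the (Lipschitz in $\bm x$) solution of $$\partial_t u=\operatorname{div}^{\Phi}\bm F(u)\ \text{ in }\mathbb R^d\times(0,\infty),\qquad u(\cdot,0)=u_0.$$ Let $\eta\in C^2(\mathbb R)$ be a convex entropy function, and define the entropy fluxes $\mathfrak q^\pm$ by $\partial_u\mathfrak q^\pm(\bm y,u)=\eta'(u)\,\partial_u\mathfrak f^\pm(\bm y,u)$ and $\mathfrak q^\pm(\bm y,0)=0$. Then, for almost all $(\bm x,t)$, $$\partial_t\eta(u(\bm x,t))\le\int_{\mathbb R^d}\frac{\Phi'(|\bm y|)}{|\bm y|^d}\Bigl\{\mathfrak q^+(\bm y,u(\bm x,t))-\mathfrak q^+(\bm y,u(\bm x+\bm y,t))+\mathfrak q^-(\bm y,u(\bm x,t))-\mathfrak q^-(\bm y,u(\bm x-\bm y,t))\Bigr\}\,d\bm w(\bm y).$$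
   Context: Increasing and decreasing parts: for a (locally) Lipschitz $f:\mathbb R\to\mathbb R$, $f^+(u)=\int_0^u\max\{0,f'(s)\}\,ds$ and $f^-(u)=\int_0^u\min\{0,f'(s)\}\,ds$. For $\bm y\in\mathbb R^d$, $u\in\mathbb R$ set $\mathfrak f^{\pm}(\bm y,u)=\pm[\bm F\cdot\bm y]^{\pm}(u)$, where $[\bm F\cdot\bm y](u)=\bm F(u)\cdot\bm y$. Thus $\mathfrak q^\pm(\bm y,u)=\int_0^u\eta'(s)\,\partial_s\mathfrak f^\pm(\bm y,s)\,ds$. $S^{d-1}$ is the unit sphere of $\mathbb R^d$ ($S^0=\{1,-1\}$), $\bm n_\theta$ is the outward unit normal at $\theta\in S^{d-1}$, and $\bm e_i$ is the $i$th standard basis vector. From the measure $w$ on $S^{d-1}$ define the measure $\bm w$ on $\mathbb R^d$ in radial coordinates $\bm y=r\bm n_\theta$ by $d\bm w(\bm y)=r^{d-1}\,dr\,dw(\theta)$. Average upwind divergence of $\bm F(u)$ with filter $\Phi$: $$\operatorname{div}^{\Phi}\bm F(u)(\bm x)=\int_{\mathbb R^d}\frac{\Phi'(|\bm y|)}{|\bm y|^d}\Bigl\{\mathfrak f^+(\bm y,u(\bm x))-\mathfrak f^+(\bm y,u(\bm x+\bm y))+\mathfrak f^-(\bm y,u(\bm x))-\mathfrak f^-(\bm y,u(\bm x-\bm y))\Bigr\}\,d\bm w(\bm y).$$ Integrals of this form are understood in radial coordinates, using $\mathfrak f^\pm(r\bm n_\theta,u)=r\,\mathfrak f^\pm(\bm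 n_\theta,u)$ and $\mathfrak q^\pm(r\bm n_\theta,u)=r\,\mathfrak q^\pm(\bm n_\theta,u)$: e.g. the one above is $\int_{S^{d-1}}\int_0^\infty\{\mathfrak f^+(\bm n_\theta,u(\bm x))-\mathfrak f^+(\bm n_\theta,u(\bm x+r\bm n_\theta))+\mathfrak f^-(\bm n_\theta,u(\bm x))-\mathfrak f^-(\bm n_\theta,u(\bm x-r\bm n_\theta))\}\,\Phi'(r)\,dr\,dw(\theta)$. Here $\Phi'(r)\,dr$ is the (non-positive) distributional derivative of $\Phi$ on $(0,\infty)$; at a jump at $r_0>0$ it is a Dirac measure with mass $\Phi(r_0^+)-\Phi(r_0^-)$. $\Phi(0)$ means $\lim_{r\to0^+}\Phi(r)$. Solution: the unique continuously differentiable map $[0,\infty)\ni t\mapsto u(\cdot,t)\in L^\infty(\mathbb R^d)$ satisfying the equation as an ordinary differential equation in $L^\infty(\mathbb R^d)$; it is Lipschitz continuous in $\bm x$ when $u_0$ is. *)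

(* Defs.v *)
From HB Require Import structures.
From mathcomp Require Import all_boot all_order all_algebra.
From mathcomp Require Import all_classical all_reals all_analysis.
From mathcomp Require Import measurable_realfun.

Set Implicit Arguments.
Unset Strict Implicit.
Unset Printing Implicit Defensive.
Import Order.TTheory GRing.Theory Num.Theory.
Import numFieldNormedType.Exports.
Local Open Scope classical_set_scope.
Local Open Scope ring_scope.

(* Matrices, in particular 'rV[R]_d, carry their Borel sigma-algebra. *)
HB.instance Definition _ (R : realType) (m n : nat) :=
  Measurable.copy 'M[R]_(m, n) (g_sigma_algebraType (@open 'M[R]_(m, n))).

Section lebesgue_measure_rV.
Context {R : realType}.

Lemma measurable_fun_mx d (T : measurableType d) m n (f : T -> 'M[R]_(m, n)) :
  (forall i j, measurable_fun setT (fun x => f x i j)) -> measurable_fun setT f.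
Proof.
move=> mf; apply: (@measurability _ _ _ _ _ _ (@open 'M[R]_(m, n))) => //.
move=> _ [U oU <-]; rewrite setTI.
pose e (k : nat) : R := k.+1%:R^-1.
pose c (q : 'M[rat]_(m, n)) : 'M[R]_(m, n) := map_mx ratr q.
have e0 k : 0 < e k by rewrite invr_gt0.
pose D := [set p : 'M[rat]_(m, n) * nat | ball (c p.1) (e p.2) `<=` U].
have -> : f @^-1` U = \bigcup_(p in D) f @^-1` ball (c p.1) (e p.2).
  apply/seteqP; split => [x Ux|x [p pU]]; last exact: pU.
  have : nbhs (f x) U by apply: open_nbhs_nbhs.
  move=> /nbhs_ballP[_/posnumP[r]] rU.
  have [k kr] : exists k, e k < r%:num / 2.
    have := @near_infty_natSinv_lt R (PosNum (divr_gt0 (gt0 r) (ltr0n R 2))).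
    by move=> [N _ /(_ N (leqnn N))] /=; exists N.
  have /choice[g hg] : forall ij : 'I_m * 'I_n, exists q : rat,
      `|ratr q - f x ij.1 ij.2| < e k.
    move=> [i j] /=.
    have /rat_in_itvoo[q] : f x i j - e k < f x i j + e k.
      by rewrite ltrBlDr -addrA ltrDl addr_gt0.
    by rewrite in_itv /= => qe; exists q; rewrite ltr_distl.
  have bx : ball (c (\matrix_(i, j) g (i, j))) (e k) (f x).
    by split => // i j; rewrite !mxE; exact: (hg (i, j)).
  exists (\matrix_(i, j) g (i, j), k) => //= y cy; apply: rU.
  have : ball (f x) (e k + e k) y by apply: ball_triangle cy; exact: ball_sym.
  by apply: le_ball; rewrite [leRHS]splitr lerD// ltW.
rewrite bigcup_mkcond; apply: countable_bigcupT_measurable => // -[q k].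
case: ifP => // _ /=.
have -> : f @^-1` ball (c q) (e k) =
    \bigcap_(ij in [set: 'I_m * 'I_n])
      (fun x => f x ij.1 ij.2) @^-1` ball (c q ij.1 ij.2) (e k).
  apply/seteqP; split => [x [_ xb] [i j] _|x xb]; first exact: xb.
  by split => // i j; exact: (xb (i, j)).
apply: fin_bigcap_measurable => // -[i j] _ /=.
rewrite -[X in measurable X]setTI; apply: mf => //.
exact: measurable_ball.
Qed.

Definition rcons_rV d (p : 'rV[R]_d * R) : 'rV[R]_d.+1 :=
  \row_j if unlift ord_max j is Some i then p.1 0 i else p.2.

Lemma continuous_measurable_fun_rV d (g : 'rV[R]_d -> R) :
  continuous g -> measurable_fun setT g.
Proof.
move=> /continuousP cg.
apply: (measurability _ (RGenOpens.measurableE R)) => _ [_ [a [b ->]] <-].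
by rewrite setTI; apply: sub_sigma_algebra; apply: cg; exact: interval_open.
Qed.

Lemma measurable_rcons_rV d :
  measurable_fun setT (@rcons_rV d : 'rV[R]_d * measurableTypeR R -> _).
Proof.
apply: measurable_fun_mx => i j.
rewrite /rcons_rV; case: (unliftP ord_max j) => [k ->|->].
  under eq_fun do rewrite mxE liftK.
  apply: (@measurableT_comp _ _ _ _ _ _ (fun v : 'rV[R]_d => v 0 k) _ fst) => //.
  by apply: continuous_measurable_fun_rV; exact: coord_continuous.
by under eq_fun do rewrite mxE unlift_none; exact: measurable_snd.
Qed.

Definition lebesgue_rV_succ d (mu : {measure set 'rV[R]_d -> \bar R}) :
    {measure set 'rV[R]_d.+1 -> \bar R} :=
  measure_function_pushforward__canonical__measure_function_Measure
    [the {measure set _ -> \bar R} of (mu \x lebesgue_measure)%E]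
    (@measurable_rcons_rV d).

Fixpoint lebesgue_rV (d : nat) : {measure set 'rV[R]_d -> \bar R} :=
  match d with
  | 0 => \d_(0 : 'rV[R]_0)
  | n.+1 => lebesgue_rV_succ (lebesgue_rV n)
  end.

End lebesgue_measure_rV.
Arguments lebesgue_rV : clear implicits.

Section filter.
Context {R : realType}.

Record filter_function := FilterFunction {
  filter_fun :> R -> R ;
  filter_ge0 : forall r, 0 < r -> 0 <= filter_fun r ;
  filter_nonincreasing :
    forall r s, 0 < r -> r <= s -> filter_fun s <= filter_fun r ;
  filter_cvg_at0 : cvg (filter_fun r @[r --> 0^'+]) }.

Variable Phi : filter_function.

(* r |-> - Phi(r+), extended to r <= 0 by the constant - Phi(0+). *)
Definition filter_cumulative (r : R) : R :=
  - lim (Phi s @[s --> (Num.max r 0)^'+]).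

Lemma filter_is_cvg a : 0 <= a -> cvg (Phi s @[s --> a^'+]).
Proof.
rewrite le_eqVlt => /predU1P[<-|a0]; first exact: filter_cvg_at0.
apply: nonincreasing_at_right_is_cvgr; apply: nearW => b.
  move=> x y; rewrite !in_itv/= => /andP[ax _] _ xy.
  by apply: filter_nonincreasing => //; exact: lt_trans ax.
exists (Phi a); apply/ubP => z [y /=]; rewrite in_itv/= => /andP[ay _] <-.
by apply: filter_nonincreasing => //; exact: ltW.
Qed.

Lemma filter_lim_ge a s : 0 <= a -> a < s ->
  Phi s <= lim (Phi r @[r --> a^'+]).
Proof.
move=> a0 as_; apply: limr_ge; first exact: filter_is_cvg.
near=> r; apply: filter_nonincreasing.
- by apply: (le_lt_trans a0); near: r; exact: nbhs_right_gt.
- by near: r; exact: nbhs_right_le.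
Unshelve. all: by end_near. Qed.

Lemma filter_lim_le a s : 0 <= a -> 0 < s -> s <= a ->
  lim (Phi r @[r --> a^'+]) <= Phi s.
Proof.
move=> a0 s0 sa; apply: limr_le; first exact: filter_is_cvg.
near=> r; apply: filter_nonincreasing => //; apply: (le_trans sa).
by near: r; exact: nbhs_right_ge.
Unshelve. all: by end_near. Qed.

Let max0 r : 0 <= Num.max r 0 :> R.
Proof. by rewrite le_max lexx orbT. Qed.

Lemma filter_cumulative_nd : nondecreasing filter_cumulative.
Proof.
move=> r s rs; rewrite /filter_cumulative lerN2.
have : Num.max r 0 <= Num.max s 0 by rewrite ge_max !le_max rs lexx orbT.
rewrite le_eqVlt => /predU1P[->//|rs'].
apply: (@le_trans _ _ (Phi (Num.max s 0))).
  by apply: filter_lim_le => //; exact: le_lt_trans rs'.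
exact: filter_lim_ge.
Qed.

Lemma filter_cumulative_rc : right_continuous filter_cumulative.
Proof.
move=> r; have [r0|r0] := ltP r 0.
  apply: cvg_near_cst; near=> s; rewrite /filter_cumulative.
  have s0 : s <= 0 by near: s; exact: nbhs_right_le.
  by rewrite !max_r// ltW.
rewrite /filter_cumulative; apply: cvgN; rewrite (max_l r0).
have /cvgrPdist_le cPhi := filter_is_cvg r0.
apply/cvgrPdist_le => e e0; have := cPhi _ e0.
move=> [d /= d0 dPhi]; near=> s.
have rs : r < s by near: s; exact: nbhs_right_gt.
have sd : s < r + d by near: s; apply: nbhs_right_lt; rewrite ltrDl.
rewrite max_l; last by rewrite (le_trans r0)// ltW.
have s0 : 0 <= s by rewrite (le_trans r0)// ltW.
have ls : lim (Phi z @[z --> s^'+]) <= lim (Phi z @[z --> r^'+]).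
  apply: (@le_trans _ _ (Phi s)); last exact: filter_lim_ge.
  by apply: filter_lim_le => //; exact: le_lt_trans rs.
rewrite ger0_norm ?subr_ge0//.
have [m /andP[sm md]] : exists m, s < m < r + d.
  by exists ((s + (r + d)) / 2); rewrite !midf_lt.
have rm : r < m by exact: lt_trans sm.
have := dPhi m; rewrite /ball_ /= ltr0_norm ?subr_lt0// opprB ltrBlDl.
move=> /(_ md rm); rewrite ger0_norm ?subr_ge0; last exact: filter_lim_ge.
by apply: le_trans; rewrite lerD2l lerN2; exact: filter_lim_ge.
Unshelve. all: by end_near. Qed.

HB.instance Definition _ := isCumulative.Build R _ R filter_cumulative
  filter_cumulative_nd filter_cumulative_rc.

(* The non-negative measure - Phi'(r) dr: it has no mass on ]-oo, 0], and mass
   Phi(r-) - Phi(r+) at r > 0. *)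
Definition filter_measure : {measure set (measurableTypeR R) -> \bar R} :=
  lebesgue_stieltjes_measure filter_cumulative.

End filter.
Arguments filter_function : clear implicits.

Section flux.
Context {R : realType}.
Implicit Types (f g eta : R -> R) (u : R).

Definition oriented_integral g u : R :=
  if 0 <= u then \int[lebesgue_measure]_(s in `[0, u]) g s
  else - \int[lebesgue_measure]_(s in `[u, 0]) g s.

(* When f is Lipschitz, its derivative exists almost everywhere; the value of
   the total operator derive1 on the remaining null set is irrelevant. *)
Definition increasing_part f u : R :=
  oriented_integral (fun s => Num.max 0 (derive1 f s)) u.

Definition decreasing_part f u : R :=
  oriented_integral (fun s => Num.min 0 (derive1 f s)) u.

Definition dotp d (x y : 'rV[R]_d) : R := \sum_i x 0 i * y 0 i.

Definition unit_sphere {d} : set 'rV[R]_d := [set y | Num.sqrt (dotp y y) = 1].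

Definition std_basis d (i : 'I_d) : 'rV[R]_d := delta_mx 0 i.

Variables (d : nat) (F : R -> 'rV[R]_d).

Definition flux_plus (y : 'rV[R]_d) : R -> R :=
  increasing_part (fun s => dotp (F s) y).

Definition flux_minus (y : 'rV[R]_d) (u : R) : R :=
  - decreasing_part (fun s => dotp (F s) y) u.

Definition entropy_flux_plus eta (y : 'rV[R]_d) : R -> R :=
  oriented_integral (fun s => derive1 eta s * derive1 (flux_plus y) s).

Definition entropy_flux_minus eta (y : 'rV[R]_d) : R -> R :=
  oriented_integral (fun s => derive1 eta s * derive1 (flux_minus y) s).

Variables (Phi : filter_function R) (w : {measure set 'rV[R]_d -> \bar R}).

(* The measure on the sphere is given as a Borel measure w on R^d, of which only
   the restriction to the sphere is ever used.
   \int_{R^d} Phi'(|y|) / |y|^d G(y) dW(y) in radial coordinates y = r theta,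
   dW(y) = r^(d-1) dr dw(theta); the sign is that of
   Phi'(r) dr = - filter_measure Phi. *)
Definition filter_integral (G : 'rV[R]_d -> R) : R :=
  - \int[w]_(theta in unit_sphere) \int[filter_measure Phi]_(r in `]0, +oo[)
      (r ^- d * G (r *: theta) * r ^+ d.-1).

Definition upwind_divergence (u : 'rV[R]_d -> R) (x : 'rV[R]_d) : R :=
  filter_integral (fun y =>
    flux_plus y (u x) - flux_plus y (u (x + y)) +
    flux_minus y (u x) - flux_minus y (u (x - y))).

End flux.

Section solution.
Context {R : realType} {d : nat}.
Local Notation leb := (lebesgue_rV R d).

(* v is the derivative on [0, +oo[ (one-sided at 0) of the curve t |-> u t in
   L^oo(R^d). *)
Definition Linfty_derivative (u v : R -> 'rV[R]_d -> R) : Prop :=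
  forall t, 0 <= t ->
    ('N[leb]_+oo[EFin \o (fun x => (s - t)^-1 * (u s x - u t x) - v t x)%R])%E
      @[s --> within [set s | 0 <= s] t^'] --> 0%E.

Definition Linfty_continuous (v : R -> 'rV[R]_d -> R) : Prop :=
  forall t, 0 <= t ->
    ('N[leb]_+oo[EFin \o (fun x => v s x - v t x)%R])%E
      @[s --> within [set s | 0 <= s] (nbhs t)] --> 0%E.

(* The equation is an identity in L^oo: it holds for every t > 0 and almost every
   x. The divergence is computed from the representatives u t. *)
Definition upwind_solution (F : R -> 'rV[R]_d)
    (w : {measure set 'rV[R]_d -> \bar R}) (Phi : filter_function R)
    (u0 : 'rV[R]_d -> R) (u : R -> 'rV[R]_d -> R) : Prop :=
  (forall t, 0 <= t -> u t \in Lfun leb +oo%E) /\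
  (exists v : R -> 'rV[R]_d -> R,
    [/\ forall t, 0 <= t -> v t \in Lfun leb +oo%E,
        Linfty_derivative u v,
        Linfty_continuous v &
        forall t, 0 < t -> v t = upwind_divergence F Phi w (u t) %[ae leb]]) /\
  u 0 = u0 %[ae leb].

End solution.

(* Main.v *)
Require Import Defs.
From HB Require Import structures.
From mathcomp Require Import all_boot all_order all_algebra.
From mathcomp Require Import all_classical all_reals all_analysis.
From mathcomp Require Import measurable_realfun ess_sup_inf.
From mathcomp Require Import ring lra.

Set Implicit Arguments.
Unset Strict Implicit.
Unset Printing Implicit Defensive.
Import Order.TTheory GRing.Theory Num.Theory.
Import numFieldNormedType.Exports.
Local Open Scope classical_set_scope.
Local Open Scope ring_scope.

(* Because the solution is Lipschitz in x, the inequality holds for every x and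
   every t > 0.  For Lipschitz bounded v the divergence of v is continuous in x,
   and so are the difference quotients (u(s, x) - u(t, x)) / (s - t); since
   Lebesgue measure charges every nonempty open set, their L^oo convergence is
   uniform convergence, and u(., x) is differentiable at t with derivative
   div F(u(., t))(x).
   It remains to compare the integrands.  Write D(y, s) = max(0, (F . y)'(s)); as
   f^-(y, .) = f^+(-y, .), both fluxes are integrals of D(y, .) or D(-y, .), and
   both entropy fluxes are integrals of eta' D by Lebesgue differentiation.  Since
   eta' is nondecreasing and D >= 0,
     int_b^a eta' D <= eta'(a) int_b^a D     for all a and b,
   which is integrated against the non-positive measure Phi'(r) dr dw. *)

(** * Measurability of integrals depending on a parameter *)

(** Extend the integrand by zero off [D] and apply Tonelli to its positive and negative parts;
    [fine] then returns a measurable real function. This supplies the measurability in the sphere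
    variable and of the fluxes in [(y, u)]. *)
Lemma measurable_fun_Rintegral d1 d2 (T1 : measurableType d1)
    (T2 : measurableType d2) (R : realType)
    (mu : {sigma_finite_measure set T2 -> \bar R}) (D : set T2)
    (k : T1 * T2 -> R) :
  measurable D -> measurable_fun setT k ->
  measurable_fun setT (fun x => \int[mu]_(y in D) k (x, y)).
Proof.
move=> mD mk; apply: measurableT_comp; first exact: fine_measurable.
pose kD p : \bar R := ((fun y => (k (p.1, y))%:E) \_ D) p.2.
have mkD : measurable_fun setT kD.
  rewrite [kD](_ : _ = fun p => (k p * \1_(setT `*` D) p)%:E); last first.
    apply/funext => -[x y]; rewrite /kD patchE indicE in_setX in_setT/=.
    by case: (y \in D); rewrite ?mulr1 ?mulr0.
  apply/measurable_EFinP/measurable_funM => //.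
  by apply: measurable_indic; exact: measurableX.
rewrite [X in measurable_fun _ X](_ : _ = fun x =>
    fubini_F mu (kD^\+)%E x - fubini_F mu (kD^\-)%E x)%E; last first.
  apply/funext => x; rewrite integral_mkcond integralE /fubini_F.
  by congr (_ - _)%E; apply: eq_integral => y _; rewrite ?funeposE ?funenegE.
apply: emeasurable_funB; apply: measurable_fun_fubini_tonelli_F => //.
- exact: measurable_funepos.
- exact: measurable_funeneg.
Qed.

(** * The derivative as a total operator: scaling, bounds, measurability *)

Section derive1_total.
Context {R : realType}.
Implicit Types f : R -> R.

(** For [c] nonzero, the quotients of [f] and of its multiple converge together; when they diverge,
    both limits take the default value 0. Hence the rule holds at every point, not only almost
    everywhere. *)
Lemma derive1Z_total f c s :
  derive1 (fun t => c * f t) s = c * derive1 f s.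
Proof.
rewrite /derive1; set q := fun h : R => h^-1 *: (f (h + s) - f s).
rewrite [X in lim (X @ _)](_ : _ = fun h => c *: q h); last first.
  by apply/funext => h; rewrite /q -mulrBr scalerAr.
have [->|c0] := eqVneq c 0.
  by under eq_fun do rewrite scale0r; rewrite mul0r lim_cst.
have [cq|ncq] := pselect (cvg (q @ 0^')).
  by rewrite limZr.
have ncq' : ~ cvg ((fun h => c *: q h) @ 0^').
  apply: contra_not ncq => cq; rewrite (_ : q = fun h => c^-1 *: (c *: q h)).
    exact: is_cvgZr.
  by apply/funext => h; rewrite scalerK.
by rewrite (dvgP ncq) (dvgP ncq') mulr0.
Qed.

(** The bound on the quotients passes to their limit, and the default value 0 satisfies it where
    there is no limit. *)
Lemma derive1_bounded f k s :
  0 <= k -> (forall x y, `|f x - f y| <= k * `|x - y|) -> `|derive1 f s| <= k.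
Proof.
move=> k0 fk; rewrite /derive1; set q := fun h : R => h^-1 *: (f (h + s) - f s).
have [cq|/dvgP ->] := pselect (cvg (q @ 0^')); last by rewrite normr0.
have qk : \forall h \near 0^', `|q h| <= k.
  near=> h; have h0 : h != 0 by near: h; exact: nbhs_dnbhs_neq.
  rewrite /q normrZ normfV ler_pdivrMl ?normr_gt0// mulrC.
  by rewrite (le_trans (fk _ _))// addrK.
rewrite ler_norml; apply/andP; split.
- by apply: limr_ge => //; apply: filterS qk => h; rewrite ler_norml => /andP[].
- by apply: limr_le => //; apply: filterS qk => h; rewrite ler_norml => /andP[].
Unshelve. all: by end_near. Qed.

(* Off the set of points of differentiability [derive1] takes the constant junk
   value 0, so its Borel measurability needs no Rademacher theorem: that set is
   described by a Cauchy criterion restricted to rational increments. *)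
Lemma measurable_fun_derive1 d (T : measurableType d) (f : T -> R -> R) :
  (forall x, continuous (f x)) ->
  measurable_fun setT (fun p : T * measurableTypeR R => f p.1 p.2) ->
  measurable_fun setT (fun p : T * measurableTypeR R => derive1 (f p.1) p.2).
Proof.
move=> cf mf.
pose q (p : T * measurableTypeR R) (h : R) := h^-1 *: (f p.1 (h + p.2) - f p.1 p.2).
have mq h : measurable_fun setT (q ^~ h).
  apply: measurable_funM => //; apply: measurable_funB => //.
  apply: (measurableT_comp mf (_ : measurable_fun setT
    (fun p : T * measurableTypeR R => (p.1, h + p.2)))).
  apply: measurable_fun_pair => //; exact: measurable_funD.
pose e (n : nat) : R := n.+1%:R^-1.
have e0 n : 0 < e n by rewrite invr_gt0.
have e_small x : 0 < x -> exists n, e n < x.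
  move=> x0; have [N _ /(_ N (leqnn N))] := near_infty_natSinv_lt (PosNum x0).
  by exists N.
pose small m (a : R) := 0 < `|a| < e m.
(* [B n m] bounds by [e n] the oscillation of the quotients over rational increments smaller than
   [e m]. [C] is the Cauchy criterion, assembled from countably many measurable conditions. *)
pose B n m := [set p | forall ab : rat * rat,
  small m (ratr ab.1) -> small m (ratr ab.2) ->
  `|q p (ratr ab.1) - q p (ratr ab.2)| <= e n].
pose C := \bigcap_n \bigcup_m B n m.
have mC : measurable C.
  apply: bigcapT_measurable => n; apply: bigcupT_measurable => m.
  rewrite [B n m](_ : _ = \bigcap_(ab in [set: rat * rat])
    [set p | small m (ratr ab.1) -> small m (ratr ab.2) ->
      `|q p (ratr ab.1) - q p (ratr ab.2)| <= e n]); last first.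
    by apply/seteqP; split => [p Bp ab _|p Bp ab]; exact: Bp.
  rewrite -[X in measurable X]setCK setC_bigcap; apply: measurableC.
  apply: countable_bigcupT_measurable => // -[a b]; apply: measurableC.
  have [sa|nsa] := pselect (small m (ratr a)); last first.
    by rewrite [X in measurable X](_ : _ = setT)//; apply/seteqP; split => // p _ /nsa.
  have [sb|nsb] := pselect (small m (ratr b)); last first.
    by rewrite [X in measurable X](_ : _ = setT)//; apply/seteqP; split => // p _ _ /nsb.
  rewrite [X in measurable X](_ : _ =
    (fun p => `|q p (ratr a) - q p (ratr b)|) @^-1` `]-oo, e n]); last first.
    by apply/seteqP; split => p /=; rewrite in_itv/=; [exact|].
  rewrite -[X in measurable X]setTI.
  by apply: (measurableT_comp (@normr_measurable _ _) (measurable_funB (mq _) (mq _))).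
(* The quotient is continuous in a nonzero increment, so density of the rationals carries the Cauchy
   bounds to all real increments. *)
have q_rat p m (h x : R) : 0 < x -> small m h ->
    exists2 a : rat, small m (ratr a) & `|q p h - q p (ratr a)| < x.
  move=> x0 /andP[h0 hm]; have hn0 : h != 0 by rewrite -normr_gt0.
  have cq : q p @ h --> q p h.
    apply: cvgM; first exact: cvgV.
    apply: cvgB; last exact: cvg_cst.
    by apply: (continuous_comp (cvgD cvg_id (cvg_cst _))); exact: cf.
  have : \forall y \near h, small m y /\ `|q p h - q p y| < x.
    near=> y; split; last by near: y; move/cvgrPdist_lt : cq; exact.
    apply/andP; split; near: y.
      by apply: (cvgr_gt _ (cvg_norm cvg_id)).
    by apply: (cvgr_lt _ (cvg_norm cvg_id)).
  move=> /nbhs_ballP[r /= r0 hr].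
  have hr0 : ball h r !=set0 by exists h; exact: ballxx.
  have [y [/hr hy [a _ ay]]] := dense_rat hr0 (ball_open _ _).
  by exists a; rewrite ay; apply hy.
have Cq p : C p -> forall n, exists m, forall a b, small m a -> small m b ->
    `|q p a - q p b| <= e n.
  move=> Cp n; have [m _ Bp] := Cp n I; exists m => a b sa sb.
  apply/ler_addgt0Pr => x x0; have x20 : 0 < x / 2 by rewrite divr_gt0.
  have [a' sa' qa] := q_rat p m a _ x20 sa; have [b' sb' qb] := q_rat p m b _ x20 sb.
  have -> : q p a - q p b = (q p a - q p (ratr a')) +
     (q p (ratr a') - q p (ratr b')) - (q p b - q p (ratr b')) by ring.
  have := Bp (a', b') sa' sb'; rewrite /= => qab.
  rewrite (le_trans (ler_normB _ _))// (splitr x) [leRHS]addrA lerD ?(ltW qb)//.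
  by rewrite (le_trans (ler_normD _ _))// [leRHS]addrC lerD// ltW.
(* By completeness [C] is exactly the set of convergence; the quotient at the admissible increment
   [e m / 2] serves as centre of the Cauchy ball. *)
have CP p : C p <-> cvg (q p @ 0^').
  split => [Cp|cq n _].
    apply/cauchy_cvgP/cauchy_exP => x x0.
    have [n nx] := e_small _ x0; have [m qm] := Cq p Cp n.
    exists (q p (e m / 2)); change (\forall h \near 0^', ball (q p (e m / 2)) x (q p h)).
    near=> h; rewrite -ball_normE/=; apply: (le_lt_trans (qm _ _ _ _) nx).
      by rewrite /small gtr0_norm ?divr_gt0//= ltr_pdivrMr// ltr_pMr// ltr1n.
    apply/andP; split; last by near: h; exact: dnbhs0_lt.
    by rewrite normr_gt0; near: h; exact: nbhs_dnbhs_neq.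
  move/cvgrPdist_lt : cq => /(_ (e n / 2)); rewrite divr_gt0// => /(_ isT).
  move=> [r /= r0 qr]; have [m mr] := e_small _ r0.
  have qlim a : small m a -> `|lim (q p @ 0^') - q p a| < e n / 2.
    move=> /andP[a0 am]; apply: qr; last by rewrite -normr_gt0.
    by rewrite /ball_/= sub0r normrN (lt_trans am).
  exists m => // -[a b] /= /qlim qa /qlim qb.
  rewrite -(subrKA (lim (q p @ 0^'))) (le_trans (ler_normD _ _))// (splitr (e n)).
  by rewrite lerD ?ltW// distrC.
have -> : (fun p => derive1 (f p.1) p.2) =
    (fun p : T * measurableTypeR R => if p \in C then lim (q p @ 0^') else 0).
  apply/funext => p; case: ifPn => //; rewrite notin_setE => nCp.
  by rewrite /derive1; apply: dvgP => /CP.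
(* On [C] the full limit is also the limit along the increments [e n], so the derivative is a
   pointwise limit of measurable functions. *)
apply: (@measurable_fun_cvg _ _ _ _ (fun n p => if p \in C then q p (e n) else 0)).
  move=> n; apply: measurable_fun_ifT => //.
  by apply: (measurable_fun_bool true); rewrite setTI preimage_mem_true.
move=> p _; case: ifPn => [|_]; last exact: cvg_cst.
rewrite inE => /CP /cvgr_dnbhsP; apply; split; last exact: cvg_harmonic.
by move=> n; rewrite gt_eqF.
Unshelve. all: by end_near. Qed.
End derive1_total.

(** * Oriented integrals of locally bounded functions and their derivatives *)

Section oriented_integral.
Context {R : realType}.
Local Notation mu := (@lebesgue_measure R).
Implicit Types (h rho : R -> R) (a b : R).

Definition locally_bounded h :=
  forall M, exists C, forall s, `|s| <= M -> `|h s| <= C.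

Lemma continuous_locally_bounded rho : continuous rho -> locally_bounded rho.
Proof.
move=> crho M.
have : compact (rho @` `[- M, M]).
  by apply: continuous_compact; [exact: continuous_subspaceT|exact: segment_compact].
move=> /compact_bounded [N [_ rhoN]]; exists (N + 1) => s sM.
apply: rhoN; first by rewrite ltrDl.
by exists s => //; rewrite /= in_itv/= -ler_norml.
Qed.

Lemma locally_boundedM rho h k : locally_bounded rho -> (forall s, `|h s| <= k) ->
  locally_bounded (fun s => rho s * h s).
Proof.
move=> brho hk M; have [C rhoC] := brho M; exists (C * k) => s sM.
by rewrite normrM ler_pM// rhoC.
Qed.

Lemma locally_bounded_integrable h (A : set R) M :
  measurable A -> (forall s, A s -> `|s| <= M) ->
  measurable_fun setT h -> locally_bounded h -> mu.-integrable A (EFin \o h).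
Proof.
move=> mA AM mh bh; have [C hC] := bh M.
apply: measurable_bounded_integrable => //.
- apply: (@le_lt_trans _ _ (mu `[- M, M])).
    by apply: le_measure; rewrite ?inE// => s /AM; rewrite /= in_itv/= -ler_norml.
  by rewrite lebesgue_measure_itv/=; case: ifP => // _; rewrite ltry.
- exact: measurable_funTS.
- exists C; split; first exact: num_real.
  by move=> x Cx s /AM /hC /le_trans; apply; exact: ltW.
Qed.

Lemma locally_bounded_integrable_itv h a b :
  measurable_fun setT h -> locally_bounded h -> mu.-integrable `[a, b] (EFin \o h).
Proof.
move=> mh bh; apply: (@locally_bounded_integrable _ _ (Num.max `|a| `|b|)) => // s.
rewrite /= in_itv/= ler_norml => /andP[sa sb]; rewrite lerNl !le_max.
rewrite (le_trans sb (ler_norm b)) orbT andbT.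
by rewrite -(normrN a) (le_trans _ (ler_norm (- a))) ?lerN2.
Qed.

Lemma Rintegral_itvccB h x y z : measurable_fun setT h -> locally_bounded h ->
  x <= y -> y <= z ->
  \int[mu]_(s in `[x, z]) h s - \int[mu]_(s in `[x, y]) h s =
  \int[mu]_(s in `[y, z]) h s.
Proof.
move=> mh bh xy yz; rewrite Rintegral_itvB ?bnd_simp//; last first.
  exact: locally_bounded_integrable_itv.
rewrite Rintegral_itv_obnd_cbnd//.
apply: integrableS (locally_bounded_integrable_itv y z mh bh) => //.
by apply: subset_itvr; rewrite bnd_simp.
Qed.

Lemma oriented_integralB h a b : measurable_fun setT h -> locally_bounded h ->
  a <= b ->
  oriented_integral h b - oriented_integral h a = \int[mu]_(s in `[a, b]) h s.
Proof.
move=> mh bh ab; have itvB := Rintegral_itvccB mh bh.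
rewrite /oriented_integral; case: leP => b0; case: leP => a0.
- exact: itvB.
- by rewrite opprK -(itvB a 0 b) ?(ltW a0)// subrK.
- by move: (le_lt_trans (le_trans a0 ab) b0); rewrite ltxx.
- by rewrite opprK addrC -(itvB a b 0) ?(ltW b0)// opprB addrC subrK.
Qed.

(** Lebesgue differentiation concerns primitives with a fixed lower endpoint. Applying it with all
    endpoints [- n%:R] discards countably many null sets, and every [s] lies to the right of one of
    these endpoints. *)
Lemma derive1_oriented_integral_ae h : measurable_fun setT h ->
  locally_bounded h ->
  \forall s \ae mu, derive1 (oriented_integral h) s = h s.
Proof.
move=> mh bh.
have lh : locally_integrable setT h.
  split => //; first exact: openT.
  move=> K _ cK; have [M [_ KM]] := compact_bounded cK.
  have /integrableP[_] : mu.-integrable K (EFin \o h).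
    apply: (@locally_bounded_integrable _ _ (M + 1)) => //.
      exact: compact_measurable.
    by apply: KM; rewrite ltrDl.
  exact.
have iN (n : nat) y :
    mu.-integrable [set` Interval (BLeft (- n%:R)) (BRight y)] (EFin \o h).
  exact: locally_bounded_integrable_itv.
have := ae_foralln (fun n : nat => FTC1 (iN n) lh).
apply: filterS => s hs.
pose n := Num.bound `|s|.
have ns : - n%:R < s.
  by rewrite ltrNl (le_lt_trans (ler_norm _))// normrN archi_boundP.
have [|dF <-] := hs n; first by rewrite /= lte_fin.
rewrite !derive1E; set G := (X in _ = 'D_1 X s).
have deriveB_cst (g : R -> R) c :
    derivable g s 1 -> 'D_1 (fun y => g y - c) s = 'D_1 g s.
  by move=> dg; rewrite deriveB// derive_cst subr0.
(* [G] is the primitive from [- n%:R]; after subtraction of the constant [G 0] it agrees with the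
   oriented integral on a neighbourhood of [s]. *)
rewrite -(deriveB_cst G (G 0) dF).
apply: near_eq_derive => //; near=> y.
have ny : - n%:R <= y by near: y; exact: (cvgr_ge _ cvg_id).
have n0 : - n%:R <= 0 :> R by rewrite oppr_le0.
rewrite /G /oriented_integral /=; case: leP => y0.
  by rewrite -(Rintegral_itvccB mh bh n0 y0).
by rewrite -(Rintegral_itvccB mh bh ny (ltW y0)) opprB.
Unshelve. all: by end_near. Qed.
End oriented_integral.

(** * Lipschitz maps, the scalar product and the unit sphere *)

Lemma lipschitz_ex (R : realType) (V W : normedModType R) (f : V -> W) :
  lipschitz f -> exists2 k, 0 <= k & forall x y, `|f x - f y| <= k * `|x - y|.
Proof.
move=> /pinfty_ex_gt0[k k0 fk]; exists k; first exact: ltW.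
by move=> x y; exact: (fk (x, y)).
Qed.

Lemma lipschitz_continuous_ex (R : realType) (V W : normedModType R) (f : V -> W) k :
  0 <= k -> (forall x y, `|f x - f y| <= k * `|x - y|) -> continuous f.
Proof.
move=> k0 fk x; apply/cvgrPdist_le => e e0; near=> y.
rewrite (le_trans (fk _ _))//.
rewrite (@le_trans _ _ ((k + 1) * `|x - y|)) ?ler_wpM2r ?lerDl//.
rewrite -ler_pdivlMl ?ltr_wpDl//; near: y.
by apply: cvgr_dist_le; [exact: cvg_id|rewrite mulr_gt0 ?invr_gt0 ?ltr_wpDl].
Unshelve. all: by end_near. Qed.

Section dotp.
Context {R : realType} {d : nat}.
Implicit Types x y : 'rV[R]_d.

Lemma dotpZr c x y : dotp x (c *: y) = c * dotp x y.
Proof.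
by rewrite /dotp mulr_sumr; apply: eq_bigr => i _; rewrite mxE mulrCA.
Qed.

Lemma dotpBl x x' y : dotp x y - dotp x' y = dotp (x - x') y.
Proof.
by rewrite /dotp -sumrB; apply: eq_bigr => i _; rewrite !mxE mulrBl.
Qed.

Lemma coord_le_norm x i : `|x 0 i| <= `|x|.
Proof.
rewrite {2}/Num.Def.normr/= mx_normE -[leLHS]nngE num_le.
exact: (le_bigmax _ (fun ij => `|x ij.1 ij.2|%:nng) (0, i)).
Qed.

Lemma unit_sphere_coord y i : unit_sphere y -> `|y 0 i| <= 1.
Proof.
rewrite /unit_sphere/= => y1.
rewrite -(ler_pXn2r (n := 2)) ?nnegrE// expr1n real_normK ?num_real//.
have -> : 1 = dotp y y.
  rewrite -[RHS]sqr_sqrtr ?y1 ?expr1n//.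
  by rewrite /dotp sumr_ge0// => j _; rewrite -expr2 sqr_ge0.
rewrite /dotp (bigD1 i)//= -expr2 lerDl sumr_ge0// => j _.
by rewrite -expr2 sqr_ge0.
Qed.

Lemma unit_sphereN y : unit_sphere y -> unit_sphere (- y).
Proof.
rewrite /unit_sphere/= => <-; congr Num.sqrt.
by apply: eq_bigr => i _; rewrite mxE mulrNN.
Qed.

(** The norm of row vectors is the maximum norm, while the sphere is Euclidean; each coordinate of a
    Euclidean unit vector is at most 1 in absolute value. *)
Lemma unit_sphere_norm_le1 y : unit_sphere y -> `|y| <= 1.
Proof.
move=> y1; rewrite /Num.Def.normr/= mx_normE -[leRHS]nngE num_le.
apply/bigmax_leP; split => [|[i j] _ /=]; rewrite -num_le//= ord1.
exact: unit_sphere_coord.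
Qed.

Lemma normr_dotp_le x y : `|dotp x y| <= d%:R * `|x| * `|y|.
Proof.
rewrite (le_trans (ler_norm_sum _ _ _))//.
rewrite (@le_trans _ _ (\sum_(i < d) `|x| * `|y|))//; last first.
  by rewrite sumr_const card_ord -mulrA mulr_natl.
by apply: ler_sum => i _; rewrite normrM ler_pM// coord_le_norm.
Qed.

Lemma measurable_coord i : measurable_fun setT (fun x : 'rV[R]_d => x 0 i).
Proof. by apply: continuous_measurable_fun_rV; exact: coord_continuous. Qed.

Lemma measurable_unit_sphere : measurable (@unit_sphere R d).
Proof.
have : measurable_fun setT (fun y : 'rV[R]_d => Num.sqrt (dotp y y)).
  apply: (measurableT_comp (continuous_measurable_fun (@sqrt_continuous R))).
  by apply: measurable_sum => i; apply: measurable_funM; exact: measurable_coord.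
move=> /(_ measurableT [set 1] (measurable_set1 1)); rewrite setTI.
exact.
Qed.

End dotp.

(** * A common form for the fluxes and the entropy fluxes *)

Section weighted_flux.
Context {R : realType} {d : nat}.
Local Notation mu := (@lebesgue_measure R).
Variable F : R -> 'rV[R]_d.
Implicit Types (y : 'rV[R]_d) (rho : R -> R).

Definition upwind_slope y (s : R) : R :=
  Num.max 0 (derive1 (fun t => dotp (F t) y) s).

(** The weight 1 gives the flux and the weight [derive1 eta] the entropy flux; the minus versions
    are the values at [- y]. All later estimates are made once, for a general weight. *)
Definition weighted_flux rho y : R -> R :=
  oriented_integral (fun s => rho s * upwind_slope y s).

Lemma upwind_slope_ge0 y s : 0 <= upwind_slope y s.
Proof. by rewrite le_max lexx. Qed.

Lemma upwind_slopeZ r y s : 0 <= r -> upwind_slope (r *: y) s = r * upwind_slope y s.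
Proof.
move=> r0; rewrite /upwind_slope maxr_pMr// mulr0 -derive1Z_total.
by under eq_fun do rewrite dotpZr.
Qed.

Lemma flux_plusE y : flux_plus F y = weighted_flux (fun=> 1) y.
Proof.
apply/funext => u; rewrite /flux_plus /increasing_part /weighted_flux.
by congr oriented_integral; apply/funext => s; rewrite mul1r.
Qed.

Lemma flux_minusE y : flux_minus F y = weighted_flux (fun=> 1) (- y).
Proof.
apply/funext => u; rewrite /flux_minus /decreasing_part /weighted_flux.
have E s : 1 * upwind_slope (- y) s = - Num.min 0 (derive1 (fun t => dotp (F t) y) s).
  rewrite mul1r /upwind_slope -scaleN1r; under eq_fun do rewrite dotpZr.
  by rewrite derive1Z_total mulN1r oppr_min oppr0.
under [in RHS]eq_fun do rewrite E.
(* Constant sign of the integrand lets the minus sign pass through the extended-valued integral. *)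
have N (A : set R) : \int[mu]_(s in A) - Num.min 0 (derive1 (fun t => dotp (F t) y) s)
    = - \int[mu]_(s in A) Num.min 0 (derive1 (fun t => dotp (F t) y) s).
  under [in RHS]eq_Rintegral do rewrite -[Num.min _ _]opprK.
  rewrite /Rintegral; under [in RHS]eq_integral do rewrite EFinN.
  rewrite integral_ge0N ?fineN ?opprK// => s _.
  by rewrite lee_fin oppr_ge0 ge_min lexx.
by rewrite /oriented_integral; case: ifP => _; rewrite N// opprK.
Qed.

Hypothesis F_lipschitz : lipschitz F.

Let F_continuous : continuous F.
Proof.
by have [k k0 Fk] := lipschitz_ex F_lipschitz; exact: lipschitz_continuous_ex Fk.
Qed.

(** If [k] is a Lipschitz constant of [F], then [d%:R * k * |y|] is one for the component of [F]
    along [y]; the factor [d%:R] comes from the maximum norm. *)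
Lemma upwind_slope_bounded : exists2 k, 0 <= k &
  forall y s, `|upwind_slope y s| <= k * `|y|.
Proof.
have [k k0 Fk] := lipschitz_ex F_lipschitz.
exists (d%:R * k); first by rewrite mulr_ge0.
move=> y s; rewrite ger0_norm ?upwind_slope_ge0//.
have dky : 0 <= d%:R * k * `|y| by rewrite !mulr_ge0.
rewrite ge_max dky/=.
apply: (le_trans (ler_norm _)); apply: derive1_bounded => // a b.
rewrite dotpBl (le_trans (normr_dotp_le _ _))// [leRHS]mulrAC ler_wpM2r// -mulrA.
by rewrite ler_wpM2l.
Qed.

Lemma measurable_upwind_slope :
  measurable_fun setT (fun p : 'rV[R]_d * measurableTypeR R => upwind_slope p.1 p.2).
Proof.
have cF i : continuous (fun t => F t 0 i).
  by move=> t; apply: (continuous_comp (@F_continuous t) (@coord_continuous _ _ _ 0 i (F t))).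
apply: measurable_maxr => //.
apply: (measurable_fun_derive1 (f := fun y t => dotp (F t) y)).
  move=> y t; apply: cvg_big => [|i _]; first exact: add_continuous.
  by apply: cvgM; [exact: cF|exact: cvg_cst].
apply: measurable_sum => i; apply: measurable_funM.
  exact: (measurableT_comp (continuous_measurable_fun (cF i)) measurable_snd).
exact: (measurableT_comp (measurable_coord i) measurable_fst).
Qed.

Lemma measurable_upwind_slope_section y : measurable_fun setT (upwind_slope y).
Proof. exact: (measurable_fun_pair2 y measurable_upwind_slope). Qed.

(** Joint measurability in [y] and the endpoint is what the iterated integral over directions and
    radii requires. *)
Lemma measurable_weighted_flux rho : continuous rho ->
  measurable_fun setT (fun p : 'rV[R]_d * measurableTypeR R => weighted_flux rho p.1 p.2).
Proof.
move=> crho.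
pose g (q : 'rV[R]_d * measurableTypeR R * measurableTypeR R) :=
  rho q.2 * upwind_slope q.1.1 q.2.
have mg : measurable_fun setT g.
  apply: measurable_funM.
    exact: (measurableT_comp (continuous_measurable_fun crho)).
  apply: (measurableT_comp measurable_upwind_slope (_ : measurable_fun setT
    (fun q : 'rV[R]_d * measurableTypeR R * measurableTypeR R => (q.1.1, q.2)))).
  apply: measurable_fun_pair => //.
  by apply: measurableT_comp.
have mu2 : measurable_fun setT
    (fun q : 'rV[R]_d * measurableTypeR R * measurableTypeR R => q.1.2).
  by apply: measurableT_comp.
(* The domain of integration moves with the parameter, so it is turned into a condition inside an
   integrand over the whole line. *)
pose between (f1 f2 : 'rV[R]_d * measurableTypeR R * measurableTypeR R -> R) q :=
  if f1 q <= q.2 <= f2 q then g q else 0.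
have mbetween f1 f2 : measurable_fun setT f1 -> measurable_fun setT f2 ->
    measurable_fun setT (fun p => \int[mu]_s between f1 f2 (p, s)).
  move=> mf1 mf2; apply: measurable_fun_Rintegral => //.
  apply: measurable_fun_ifT => //.
  by apply: measurable_and; apply: measurable_fun_ler.
have Ebetween p a b : \int[mu]_(s in `[a, b]) g (p, s) =
    \int[mu]_s (if a <= s <= b then g (p, s) else 0).
  by rewrite Rintegral_mkcond; apply: eq_Rintegral => s _; rewrite patchE mem_setE in_itv.
apply: measurable_fun_ifT; first exact: measurable_fun_ler.
- rewrite [X in measurable_fun _ X](_ : _ = fun p : 'rV[R]_d * measurableTypeR R =>
    \int[mu]_s between (fun=> 0) (fun q => q.1.2) (p, s)); last first.
    by apply/funext => p; rewrite -Ebetween.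
  exact: mbetween.
- rewrite [X in measurable_fun _ X](_ : _ = fun p : 'rV[R]_d * measurableTypeR R =>
    - \int[mu]_s between (fun q => q.1.2) (fun=> 0) (p, s)); last first.
    by apply/funext => p; rewrite -Ebetween.
  by apply: measurableT_comp => //; exact: mbetween.
Qed.

End weighted_flux.

(** * Lipschitz and entropy estimates for weighted fluxes *)

Section weighted_flux_estimates.
Context {R : realType} {d : nat}.
Local Notation mu := (@lebesgue_measure R).
Variable F : R -> 'rV[R]_d.
Hypothesis F_lipschitz : lipschitz F.
Implicit Types (y : 'rV[R]_d) (rho eta : R -> R).

Lemma measurable_weighted_slope rho y : continuous rho ->
  measurable_fun setT (fun s => rho s * upwind_slope F y s).
Proof.
move=> crho; apply: measurable_funM; first exact: continuous_measurable_fun.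
exact: measurable_upwind_slope_section.
Qed.

Lemma locally_bounded_weighted_slope rho y : continuous rho ->
  locally_bounded (fun s => rho s * upwind_slope F y s).
Proof.
move=> crho; have [k k0 slopek] := upwind_slope_bounded F_lipschitz.
by apply: locally_boundedM (slopek y); exact: continuous_locally_bounded.
Qed.

Lemma weighted_fluxB rho y a b : continuous rho -> a <= b ->
  weighted_flux F rho y b - weighted_flux F rho y a =
  \int[mu]_(s in `[a, b]) (rho s * upwind_slope F y s).
Proof.
move=> crho; apply: oriented_integralB; first exact: measurable_weighted_slope.
exact: locally_bounded_weighted_slope.
Qed.

Lemma integrable_weighted_slope rho y a b : continuous rho ->
  mu.-integrable `[a, b] (EFin \o (fun s => rho s * upwind_slope F y s)).
Proof.
move=> crho; apply: locally_bounded_integrable_itv.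
  exact: measurable_weighted_slope.
exact: locally_bounded_weighted_slope.
Qed.

Lemma weighted_fluxZ rho r y u : continuous rho -> 0 <= r ->
  weighted_flux F rho (r *: y) u = r * weighted_flux F rho y u.
Proof.
move=> crho r0; rewrite /weighted_flux /oriented_integral.
have Z a b : \int[mu]_(s in `[a, b]) (rho s * upwind_slope F (r *: y) s) =
    r * \int[mu]_(s in `[a, b]) (rho s * upwind_slope F y s).
  under eq_Rintegral do rewrite upwind_slopeZ// mulrCA.
  by apply: RintegralZl => //; exact: integrable_weighted_slope.
case: (0 <= u).
  exact: (Z 0 u).
by rewrite mulrN (Z u 0).
Qed.

(** Between two points of [[- M, M]] the integrand is at most [C * k * |y|]. The constant [k]
    depends on [F] alone, so it serves every weight and direction. *)
Lemma weighted_flux_lipschitz : exists2 k, 0 <= k &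
  forall rho C M, continuous rho -> (forall s, `|s| <= M -> `|rho s| <= C) ->
  forall y a b, `|a| <= M -> `|b| <= M ->
    `|weighted_flux F rho y a - weighted_flux F rho y b| <= C * k * `|y| * `|a - b|.
Proof.
have [k k0 slopek] := upwind_slope_bounded F_lipschitz; exists k => //.
move=> rho C M crho rhoC y a b.
wlog ab : a b / b <= a => [wlg aM bM|].
  have [ba|/ltW ab] := leP b a; first exact: wlg.
  by rewrite distrC (distrC a); exact: wlg.
move=> aM bM; rewrite weighted_fluxB//.
have iab := @integrable_weighted_slope rho y b a crho.
rewrite (le_trans (le_normr_Rintegral _ iab))//.
apply: (@le_trans _ _ (\int[mu]_(s in `[b, a]) (C * k * `|y|))).
  apply: le_Rintegral => //.
  - exact: integrable_norm.
  - by apply: locally_bounded_integrable_itv => // N; exists `|C * k * `|y| |.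
  - move=> s; rewrite /= in_itv/= => /andP[bs sa].
    rewrite normrM -mulrA ler_pM//; apply: rhoC.
    move: aM bM; rewrite !ler_norml => /andP[_ aM] /andP[bM _].
    by rewrite (le_trans bM bs) (le_trans sa aM).
rewrite Rintegral_cst//= lebesgue_measure_itv/= lte_fin.
case: ifPn => [_|]; first by rewrite ger0_norm ?subr_ge0.
by rewrite -leNgt => ba; rewrite (@le_anti _ _ a b) ?ab ?ba// subrr normr0.
Qed.

(** For [b <= a], monotonicity gives [rho s <= rho a] on the interval. For [a < b] it gives
    [rho a <= rho s], and the exchange of endpoints reverses the inequality back. *)
Lemma weighted_flux_entropy_le rho y a b : continuous rho ->
  nondecreasing rho ->
  weighted_flux F rho y a - weighted_flux F rho y b <=
  rho a * (weighted_flux F (fun=> 1) y a - weighted_flux F (fun=> 1) y b).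
Proof.
move=> crho ndrho; have c1 : continuous ((fun=> 1) : R -> R) by exact: cst_continuous.
have i1 := integrable_weighted_slope y _ _ c1.
have irho := integrable_weighted_slope y _ _ crho.
have [ba|/ltW ab] := leP b a.
  rewrite !weighted_fluxB// -RintegralZl//; apply: le_Rintegral => //.
  - exact: (integrableZl _ _ (i1 _ _)).
  - move=> s; rewrite /= in_itv/= => /andP[_ sa].
    by rewrite mul1r ler_wpM2r ?upwind_slope_ge0// ndrho.
rewrite -lerN2 -mulrN !opprB.
rewrite !weighted_fluxB// -RintegralZl//; apply: le_Rintegral => //.
- exact: (integrableZl _ _ (i1 _ _)).
- move=> s; rewrite /= in_itv/= => /andP[as_ _].
  by rewrite mul1r ler_wpM2r ?upwind_slope_ge0// ndrho.
Qed.

(** The entropy flux is defined through the derivative of the flux, which equals the slope only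
    almost everywhere; the integrals do not see the exceptional set. *)
Lemma entropy_flux_plusE eta y : continuous (derive1 eta) ->
  entropy_flux_plus F eta y = weighted_flux F (derive1 eta) y.
Proof.
move=> ceta; have c1 : continuous ((fun=> 1) : R -> R) by exact: cst_continuous.
have cf : continuous (flux_plus F y).
  rewrite flux_plusE; have [k k0 fk] := weighted_flux_lipschitz.
  apply: (@lipschitz_continuous_ex _ _ _ _ (k * `|y|)); first exact: mulr_ge0.
  (* The weight 1 has the same bound on every interval, so the interval may be chosen to contain [a]
     and [b], and the flux is globally Lipschitz. *)
  move=> a b; have := fk (fun=> 1) 1 (Num.max `|a| `|b|) c1 _ y a b.
  by rewrite mul1r; apply => [s _||]; rewrite ?normr1// le_max lexx ?orbT.
have mf : measurable_fun setT (derive1 (flux_plus F y)).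
  apply: (measurable_fun_pair2 tt
    (measurable_fun_derive1 (f := fun _ : unit => flux_plus F y) _ _)) => //.
  apply: (@measurableT_comp _ _ _ _ _ _ _ _ snd) => //.
  exact: continuous_measurable_fun.
have ae : \forall s \ae mu, derive1 (flux_plus F y) s = upwind_slope F y s.
  have := derive1_oriented_integral_ae (measurable_weighted_slope y c1)
    (locally_bounded_weighted_slope y c1).
  rewrite flux_plusE; apply: filterS; first exact: (ae_filter_ringOfSetsType mu).
  by move=> s ->; rewrite mul1r.
have E a b : \int[mu]_(s in `[a, b]) (derive1 eta s * derive1 (flux_plus F y) s) =
    \int[mu]_(s in `[a, b]) (derive1 eta s * upwind_slope F y s).
  congr fine; apply: ae_eq_integral => //.
  - apply: measurable_funTS; apply/measurable_EFinP; apply: measurable_funM => //.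
    exact: continuous_measurable_fun.
  - apply: measurable_funTS; apply/measurable_EFinP.
    exact: measurable_weighted_slope.
  - apply: filterS ae; first exact: (ae_filter_ringOfSetsType mu).
    by move=> s /= ->.
apply/funext => u; rewrite /entropy_flux_plus /weighted_flux /oriented_integral.
by rewrite !E.
Qed.

Lemma entropy_flux_minusE eta y : continuous (derive1 eta) ->
  entropy_flux_minus F eta y = weighted_flux F (derive1 eta) (- y).
Proof.
have E : flux_minus F y = flux_plus F (- y) by rewrite flux_minusE flux_plusE.
by move=> /entropy_flux_plusE <-; rewrite /entropy_flux_minus E.
Qed.

End weighted_flux_estimates.

(** * Bounded functions on finite measures; finiteness of the filter measure *)

Lemma bounded_integrable_finite d (T : measurableType d) (R : realType)
    (mu : {measure set T -> \bar R}) (D : set T) (f : T -> R) C :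
  measurable D -> (mu D < +oo)%E -> measurable_fun D f ->
  (forall x, D x -> `|f x| <= C) -> mu.-integrable D (EFin \o f).
Proof.
move=> mD muD mf fC; apply: measurable_bounded_integrable => //.
exists C; split; first exact: num_real.
by move=> x Cx s /fC /le_trans; apply; exact: ltW.
Qed.

Lemma normr_Rintegral_le d (T : measurableType d) (R : realType)
    (mu : {measure set T -> \bar R}) (D : set T) (f : T -> R) C :
  measurable D -> (mu D < +oo)%E -> measurable_fun D f ->
  (forall x, D x -> `|f x| <= C) ->
  `|\int[mu]_(x in D) f x| <= C * fine (mu D).
Proof.
move=> mD muD mf fC; have intf := bounded_integrable_finite mD muD mf fC.
rewrite (le_trans (le_normr_Rintegral _ intf))//.
rewrite -Rintegral_cst//; apply: le_Rintegral => //; first exact: integrable_norm.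
exact: (@bounded_integrable_finite _ _ _ _ _ _ `|C|).
Qed.

Section filter_measure_finite.
Context {R : realType}.
Variable Phi : filter_function R.

Lemma filter_measure_itvoc a b : a <= b ->
  filter_measure Phi `]a, b]%classic =
  (filter_cumulative Phi b - filter_cumulative Phi a)%:E.
Proof.
move=> ab; have -> : filter_measure Phi `]a, b]%classic =
    ((wlength (filter_cumulative Phi))^*)%mu `]a, b]%classic by [].
by rewrite measurable_mu_extE/= ?wlength_itv_bnd//; exact: is_ocitv.
Qed.

Lemma filter_cumulative_le0 r : filter_cumulative Phi r <= 0.
Proof.
rewrite /filter_cumulative oppr_le0; set m := Num.max r 0.
have m0 : 0 <= m by rewrite le_max lexx orbT.
apply: limr_ge; first exact: filter_is_cvg.
near=> s; apply: filter_ge0; apply: (le_lt_trans m0).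
by near: s; exact: nbhs_right_gt.
Unshelve. all: by end_near. Qed.

(** The mass of []0, n]] is the drop of the filter from its limit at 0 to its right limit at [n],
    hence at most the finite limit at 0; these masses increase to the total mass. *)
Lemma filter_measure_gt0_lty : (filter_measure Phi `]0%R, +oo[%classic < +oo)%E.
Proof.
pose J (n : nat) : set (measurableTypeR R) := `]0, n%:R]%classic.
have -> : `]0, +oo[%classic = \bigcup_n J n :> set R.
  apply/seteqP; split => [r|r [n _]]; rewrite /J/= !in_itv/= ?andbT.
    move=> r0; exists (Num.bound r) => //; rewrite /= in_itv/= r0/=.
    by rewrite ltW// archi_boundP// ltW.
  by case/andP.
have cJ : filter_measure Phi (J n) @[n --> \oo] --> filter_measure Phi (\bigcup_n J n).
  have mJ n : measurable (J n) by exact: measurable_itv.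
  apply: nondecreasing_cvg_mu => //; first exact: bigcupT_measurable.
  move=> m n mn; apply/subsetPset => r; rewrite /J/= !in_itv/= => /andP[-> rm]/=.
  by rewrite (le_trans rm)// ler_nat.
rewrite -(cvg_lim _ cJ)//.
apply: (@le_lt_trans _ _ (- filter_cumulative Phi 0)%:E); last exact: ltry.
apply: lime_le; first by apply/cvg_ex; eexists; exact: cJ.
apply: nearW => n; rewrite /J filter_measure_itvoc// lee_fin gerDr.
exact: filter_cumulative_le0.
Qed.

End filter_measure_finite.

(** * The iterated integral over directions and radii *)

Section sphere_filter_integral.
Context {R : realType} {d : nat}.
Variables (Phi : filter_function R) (w : {measure set 'rV[R]_d -> \bar R}).
Hypothesis w_finite : (w unit_sphere < +oo)%E.
Implicit Types k : 'rV[R]_d * measurableTypeR R -> R.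

(** For an integrand homogeneous of degree one in the explicit factor [r], the powers of [r] in
    [filter_integral] cancel and leave this integral, up to sign. *)
Definition sphere_filter_integral k : R :=
  \int[w]_(theta in unit_sphere) \int[filter_measure Phi]_(r in `]0, +oo[)
    k (theta, r).

(** Both measures are finite on the region of integration, so a measurable kernel with such a bound
    is integrable at each stage. *)
Definition bounded_by k C :=
  forall theta r, unit_sphere theta -> 0 < r -> `|k (theta, r)| <= C.

Let mS := @measurable_unit_sphere R d.

Let m := fine (filter_measure Phi `]0%R, +oo[%classic).
Let mI : measurable (`]0, +oo[%classic : set (measurableTypeR R)).
Proof. exact: measurable_itv. Qed.

Lemma integrable_radial k C theta : measurable_fun setT k -> bounded_by k C ->
  unit_sphere theta ->
  (filter_measure Phi).-integrable `]0, +oo[ (EFin \o (fun r => k (theta, r))).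
Proof.
move=> mk kC Stheta.
apply: (@bounded_integrable_finite _ _ _ _ _ _ C) => //.
- exact: filter_measure_gt0_lty.
- exact: measurable_funTS (measurable_fun_pair2 _ mk).
- by move=> r; rewrite /= in_itv/= andbT => r0; exact: kC.
Qed.

Lemma measurable_radial_integral k : measurable_fun setT k ->
  measurable_fun setT
    (fun theta => \int[filter_measure Phi]_(r in `]0, +oo[) k (theta, r)).
Proof.
(* Naming the underlying Stieltjes measure exhibits the sigma-finiteness that Tonelli asks for. *)
move=> mk; exact: (measurable_fun_Rintegral
  (lebesgue_stieltjes_measure (filter_cumulative Phi))).
Qed.

Lemma radial_integral_le k C theta : measurable_fun setT k -> bounded_by k C ->
  unit_sphere theta ->
  `|\int[filter_measure Phi]_(r in `]0, +oo[) k (theta, r)| <= C * m.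
Proof.
move=> mk kC Stheta; apply: normr_Rintegral_le => //.
- exact: filter_measure_gt0_lty.
- exact: measurable_funTS (measurable_fun_pair2 _ mk).
- by move=> r; rewrite /= in_itv/= andbT => r0; exact: kC.
Qed.

Lemma integrable_radial_integral k C : measurable_fun setT k -> bounded_by k C ->
  w.-integrable unit_sphere
    (EFin \o (fun theta => \int[filter_measure Phi]_(r in `]0, +oo[) k (theta, r))).
Proof.
move=> mk kC; apply: (@bounded_integrable_finite _ _ _ _ _ _ (C * m)) => //.
- exact: measurable_funTS (measurable_radial_integral mk).
- by move=> theta; exact: radial_integral_le.
Qed.

Lemma sphere_filter_integralB k1 k2 C1 C2 :
  measurable_fun setT k1 -> bounded_by k1 C1 ->
  measurable_fun setT k2 -> bounded_by k2 C2 ->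
  sphere_filter_integral k1 - sphere_filter_integral k2 =
  sphere_filter_integral (fun p => k1 p - k2 p).
Proof.
move=> mk1 kC1 mk2 kC2; rewrite /sphere_filter_integral -RintegralB//; last 2 first.
- exact: integrable_radial_integral kC1.
- exact: integrable_radial_integral kC2.
apply: eq_Rintegral => theta; rewrite inE => Stheta; rewrite RintegralB//.
- exact: integrable_radial kC1 _.
- exact: integrable_radial kC2 _.
Qed.

Lemma sphere_filter_integralZ c k C : measurable_fun setT k -> bounded_by k C ->
  sphere_filter_integral (fun p => c * k p) = c * sphere_filter_integral k.
Proof.
move=> mk kC; rewrite /sphere_filter_integral -RintegralZl//; last first.
  exact: integrable_radial_integral kC.
apply: eq_Rintegral => theta; rewrite inE => Stheta; rewrite RintegralZl//.
exact: integrable_radial kC _.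
Qed.

Lemma le_sphere_filter_integral k1 k2 C1 C2 :
  measurable_fun setT k1 -> bounded_by k1 C1 ->
  measurable_fun setT k2 -> bounded_by k2 C2 ->
  (forall theta r, unit_sphere theta -> 0 < r -> k1 (theta, r) <= k2 (theta, r)) ->
  sphere_filter_integral k1 <= sphere_filter_integral k2.
Proof.
move=> mk1 kC1 mk2 kC2 k12; apply: le_Rintegral => //.
- exact: integrable_radial_integral kC1.
- exact: integrable_radial_integral kC2.
move=> theta Stheta; apply: le_Rintegral => //.
- exact: integrable_radial kC1 _.
- exact: integrable_radial kC2 _.
- by move=> r; rewrite /= in_itv/= andbT => r0; exact: k12.
Qed.

Lemma normr_sphere_filter_integral_le k C :
  measurable_fun setT k -> bounded_by k C ->
  `|sphere_filter_integral k| <= C * (m * fine (w unit_sphere)).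
Proof.
move=> mk kC; rewrite mulrA; apply: normr_Rintegral_le => //.
- exact: measurable_funTS (measurable_radial_integral mk).
- by move=> theta; exact: radial_integral_le.
Qed.

Lemma filter_integralE (G : 'rV[R]_d -> R) k : (0 < d)%N ->
  (forall theta r, 0 < r -> G (r *: theta) = r * k (theta, r)) ->
  filter_integral Phi w G = - sphere_filter_integral k.
Proof.
move=> d0 Gk; congr (- _); apply: eq_Rintegral => theta _.
apply: eq_Rintegral => r; rewrite inE/= in_itv/= andbT => r0.
(* Positivity of [d] enters here, through the truncated predecessor in the exponent. *)
have rd : r ^+ d.-1 * r = r ^+ d by rewrite -exprSr prednK.
rewrite Gk// mulrC mulrCA (mulrA (r ^+ d.-1)) rd mulrA mulVf ?mul1r//.
by rewrite expf_neq0// gt_eqF.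
Qed.

End sphere_filter_integral.

(** * The upwind kernel and the comparison of the two divergences *)

Section upwind_kernel.
Context {R : realType} {d : nat}.
Variable F : R -> 'rV[R]_d.
Hypothesis F_lipschitz : lipschitz F.
Implicit Types (rho : R -> R) (v : 'rV[R]_d -> R) (x y : 'rV[R]_d).

(* The part of the integrand in [f^-] at [y] is the one in [f^+] at [- y], so the
   whole integrand is the sum of the forward kernel at [y] and at [- y]. *)
Definition forward_kernel rho v x (p : 'rV[R]_d * measurableTypeR R) : R :=
  weighted_flux F rho p.1 (v x) - weighted_flux F rho p.1 (v (x + p.2 *: p.1)).

Definition upwind_kernel rho v x (p : 'rV[R]_d * measurableTypeR R) : R :=
  forward_kernel rho v x p + forward_kernel rho v x (- p.1, p.2).

Lemma measurable_forward_kernel rho v x : continuous rho -> continuous v ->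
  measurable_fun setT (forward_kernel rho v x).
Proof.
move=> crho cv; apply: measurable_funB.
  apply: (measurableT_comp (measurable_weighted_flux F_lipschitz crho)
    (_ : measurable_fun setT (fun p : 'rV[R]_d * measurableTypeR R => (p.1, v x)))).
  by apply: measurable_fun_pair.
apply: (measurableT_comp (measurable_weighted_flux F_lipschitz crho)
  (_ : measurable_fun setT (fun p : 'rV[R]_d * measurableTypeR R =>
     (p.1, v (x + p.2 *: p.1))))).
apply: measurable_fun_pair => //.
apply: (measurableT_comp (continuous_measurable_fun_rV cv)).
apply: measurable_fun_mx => i j; rewrite (ord1 i).
under eq_fun do rewrite !mxE.
apply: measurable_funD => //; apply: measurable_funM => //.
exact: (measurableT_comp (measurable_coord j)).
Qed.

Lemma measurable_upwind_kernel rho v x : continuous rho -> continuous v ->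
  measurable_fun setT (upwind_kernel rho v x).
Proof.
move=> crho cv; have mk := measurable_forward_kernel x crho cv.
apply: (measurable_funD mk).
apply: (measurableT_comp mk
  (_ : measurable_fun setT (fun p : 'rV[R]_d * measurableTypeR R => (- p.1, p.2)))).
apply: measurable_fun_pair => //.
apply: measurable_fun_mx => i j; rewrite (ord1 i).
under eq_fun do rewrite !mxE.
by apply: measurableT_comp => //; exact: (measurableT_comp (measurable_coord j)).
Qed.

(** The values of [v] stay in [[- M, M]], where the fluxes are Lipschitz, and two of them differ by
    at most [M + M]; the two directions [y] and [- y] contribute equally. *)
Lemma bounded_by_upwind_kernel rho v x M : continuous rho ->
  (forall y, `|v y| <= M) -> exists C, bounded_by (upwind_kernel rho v x) C.
Proof.
move=> crho vM; have [k k0 Wk] := weighted_flux_lipschitz F_lipschitz.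
have [C rhoC] := continuous_locally_bounded crho M.
have C0 : 0 <= C by rewrite (le_trans _ (rhoC (v x) (vM x))).
have fC y r : unit_sphere y -> `|forward_kernel rho v x (y, r)| <= C * k * (M + M).
  move=> y1; rewrite (le_trans (Wk _ _ _ crho rhoC _ _ _ (vM _) (vM _)))//.
  rewrite -mulrA ler_wpM2l ?mulr_ge0//.
  rewrite -[leRHS]mul1r ler_pM// ?unit_sphere_norm_le1//.
  by rewrite (le_trans (ler_normB _ _))// lerD.
exists (C * k * (M + M) + C * k * (M + M)) => y r y1 _.
rewrite (le_trans (ler_normD _ _))// lerD ?fC//.
exact: unit_sphereN.
Qed.

Lemma upwind_kernelE rho v x y r : continuous rho -> 0 < r ->
  weighted_flux F rho (r *: y) (v x)
  - weighted_flux F rho (r *: y) (v (x + r *: y))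
  + weighted_flux F rho (- (r *: y)) (v x)
  - weighted_flux F rho (- (r *: y)) (v (x - r *: y))
  = r * upwind_kernel rho v x (y, r).
Proof.
move=> crho r0; rewrite -addrA /upwind_kernel /forward_kernel/= -!scalerN.
have Z z u : weighted_flux F rho (r *: z) u = r * weighted_flux F rho z u.
  by apply: weighted_fluxZ => //; exact: ltW.
rewrite (Z y (v x)) (Z y (v (x + _))) (Z (- y) (v x)) (Z (- y) (v (x + _))).
set a1 := weighted_flux _ _ _ _; set a2 := weighted_flux _ _ _ _.
set a3 := weighted_flux _ _ _ _; set a4 := weighted_flux _ _ _ _.
by clearbody a1 a2 a3 a4; rewrite mulrDr !mulrBr.
Qed.

Variables (Phi : filter_function R) (w : {measure set 'rV[R]_d -> \bar R}).
Hypotheses (d_gt0 : (0 < d)%N) (w_finite : (w unit_sphere < +oo)%E).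

Lemma upwind_divergenceE v x :
  upwind_divergence F Phi w v x =
  - sphere_filter_integral Phi w (upwind_kernel (fun=> 1) v x).
Proof.
apply: filter_integralE => // y r r0; rewrite !flux_plusE !flux_minusE.
by apply: upwind_kernelE => //; exact: cst_continuous.
Qed.

Lemma entropy_divergenceE (eta : R -> R) v x : continuous (derive1 eta) ->
  filter_integral Phi w (fun y =>
    entropy_flux_plus F eta y (v x) - entropy_flux_plus F eta y (v (x + y))
    + entropy_flux_minus F eta y (v x) - entropy_flux_minus F eta y (v (x - y))) =
  - sphere_filter_integral Phi w (upwind_kernel (derive1 eta) v x).
Proof.
move=> ceta; apply: filter_integralE => // y r r0.
by rewrite !entropy_flux_plusE// !entropy_flux_minusE//; exact: upwind_kernelE.
Qed.

(** Both sides are minus an integral against a non-negative measure, so the kernel inequality needed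
    is the opposite one: it is [weighted_flux_entropy_le] with [a = v x], in the directions [y] and
    [- y]. *)
Lemma upwind_divergence_entropy_le (eta : R -> R) v x M : continuous (derive1 eta) ->
  nondecreasing (derive1 eta) -> continuous v -> (forall y, `|v y| <= M) ->
  derive1 eta (v x) * upwind_divergence F Phi w v x <=
  filter_integral Phi w (fun y =>
    entropy_flux_plus F eta y (v x) - entropy_flux_plus F eta y (v (x + y))
    + entropy_flux_minus F eta y (v x) - entropy_flux_minus F eta y (v (x - y))).
Proof.
move=> ceta ndeta cv vM; rewrite entropy_divergenceE// upwind_divergenceE.
have c1 : continuous ((fun=> 1) : R -> R) by exact: cst_continuous.
have [C1 k1] := bounded_by_upwind_kernel x c1 vM.
have [C2 k2] := bounded_by_upwind_kernel x ceta vM.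
have m1 := measurable_upwind_kernel x c1 cv.
have m2 := measurable_upwind_kernel x ceta cv.
rewrite mulrN lerN2 -(sphere_filter_integralZ Phi w_finite _ m1 k1).
have k3 : bounded_by (fun p => derive1 eta (v x) * upwind_kernel (fun=> 1) v x p)
    (`|derive1 eta (v x)| * C1).
  by move=> y r y1 r0; rewrite normrM ler_wpM2l// k1.
have m3 := measurable_funM (measurable_cst (derive1 eta (v x))) m1.
apply: (le_sphere_filter_integral Phi w_finite m2 k2 m3 k3).
move=> y r y1 r0; rewrite /upwind_kernel/= mulrDr lerD//.
- exact: weighted_flux_entropy_le.
- exact: weighted_flux_entropy_le.
Qed.

Lemma upwind_divergence_continuous v M : lipschitz v ->
  (forall y, `|v y| <= M) -> continuous (upwind_divergence F Phi w v).
Proof.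
move=> lv vM; have [k k0 Wk] := weighted_flux_lipschitz F_lipschitz.
have [l l0 vl] := lipschitz_ex lv.
have cv : continuous v by exact: lipschitz_continuous_ex vl.
have c1 : continuous ((fun=> 1) : R -> R) by exact: cst_continuous.
have W1 y a b : unit_sphere y -> `|a| <= M -> `|b| <= M ->
    `|weighted_flux F (fun=> 1) y a - weighted_flux F (fun=> 1) y b| <= k * `|a - b|.
  move=> y1 aM bM.
  have := Wk (fun=> 1) 1 M c1 (fun s _ => _) y a b aM bM.
  rewrite normr1 => /(_ (fun=> lexx _)) /le_trans; apply.
  by rewrite mul1r ler_wpM2r// ler_piMr// unit_sphere_norm_le1.
pose m := fine (filter_measure Phi `]0%R, +oo[%classic) * fine (w unit_sphere).
have m0 : 0 <= m by rewrite mulr_ge0// fine_ge0.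
(* The kernel consists of four flux values, each varying by at most [k * l] times the distance of
   the base points; [m] is the product of the two total masses. *)
apply: (@lipschitz_continuous_ex _ _ _ _ (4 * (k * l) * m)) => [|x x'].
  by rewrite !mulr_ge0.
rewrite !upwind_divergenceE -opprD normrN.
have [C1 k1] := bounded_by_upwind_kernel x c1 vM.
have [C2 k2] := bounded_by_upwind_kernel x' c1 vM.
have m1 := measurable_upwind_kernel x c1 cv.
have m2 := measurable_upwind_kernel x' c1 cv.
rewrite (sphere_filter_integralB Phi w_finite m1 k1 m2 k2) mulrAC.
apply: (normr_sphere_filter_integral_le Phi w_finite (measurable_funB m1 m2)).
have fk y r : unit_sphere y ->
    `|forward_kernel (fun=> 1) v x (y, r) - forward_kernel (fun=> 1) v x' (y, r)| <=
    2 * (k * l) * `|x - x'|.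
  move=> y1; rewrite /forward_kernel /= opprD addrACA opprK.
  rewrite mulr_natl mulr2n mulrDl (le_trans (ler_normD _ _))// lerD//.
    by rewrite (le_trans (W1 _ _ _ y1 (vM _) (vM _)))// -mulrA ler_wpM2l// vl.
  rewrite addrC (le_trans (W1 _ _ _ y1 (vM _) (vM _)))// -mulrA ler_wpM2l//.
  by rewrite (le_trans (vl _ _))// opprD addrACA subrr addr0 distrC.
move=> y r y1 _; rewrite /upwind_kernel/= opprD addrACA.
rewrite (le_trans (ler_normD _ _))//.
have -> : 4 * (k * l) * `|x - x'| =
    2 * (k * l) * `|x - x'| + 2 * (k * l) * `|x - x'| by ring.
by rewrite lerD// fk//; exact: unit_sphereN.
Qed.

End upwind_kernel.

(** * From almost everywhere to everywhere for continuous functions *)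

Section lebesgue_rV_everywhere.
Context {R : realType}.

Lemma open_measurable_rV d (U : set 'rV[R]_d) : open U -> measurable U.
Proof. by move=> oU; exact: sub_sigma_algebra. Qed.

(** Balls of the maximum norm contain the product of a lower-dimensional ball and an interval, which
    gives an induction on the dimension, starting from the Dirac mass on the one-point space. *)
Lemma lebesgue_rV_ball_gt0 d (x : 'rV[R]_d) e : 0 < e ->
  (0 < lebesgue_rV R d (ball x e))%E.
Proof.
move=> e0; elim: d x => [|d IHd] x.
  rewrite /= diracE mem_set ?lte_fin//.
  by rewrite (thinmx0 x); exact: ballxx.
pose x' : 'rV[R]_d := \row_i x 0 (lift ord_max i).
have mball : measurable (ball x e) by apply: open_measurable_rV; exact: ball_open.
have mball' : measurable (ball x' e) by apply: open_measurable_rV; exact: ball_open.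
have : (0 < (lebesgue_rV R d \x lebesgue_measure)%E
    (ball x' e `*` (ball (x 0%R ord_max) e : set (measurableTypeR R))))%E.
  rewrite product_measure1E//; last exact: measurable_ball.
  have lball : (0 < lebesgue_measure (ball (x 0%R ord_max) e))%E.
    by rewrite lebesgue_measure_ball ?ltW// lte_fin mulrn_wgt0.
  exact: (mule_gt0 (IHd x') lball).
move=> /lt_le_trans; apply; apply: le_measure.
- by rewrite inE; apply: measurableX => //; exact: measurable_ball.
- by rewrite inE -[X in measurable X]setTI; exact: measurable_rcons_rV.
- move=> [y s] [/= [_ yb] sb]; split => // i j; rewrite (ord1 i) /rcons_rV mxE.
  case: (unliftP ord_max j) => [k ->|->]; rewrite ?liftK ?unlift_none//=.
  by have := yb 0 k; rewrite mxE.
Qed.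

(** The definition of the L^oo norm tests whether the total mass is positive; this selects the case
    of the essential supremum. *)
Lemma lebesgue_rV_setT_gt0 d : (0 < lebesgue_rV R d setT)%E.
Proof.
apply: lt_le_trans (lebesgue_rV_ball_gt0 0 ltr01) _; apply: le_measure => //.
- by rewrite inE; apply: open_measurable_rV; exact: ball_open.
- by rewrite inE.
Qed.

(** A violation at one point persists on a ball around it, and a ball is not a null set. *)
Lemma continuous_ae_le d (f g : 'rV[R]_d -> R) : continuous f -> continuous g ->
  (\forall x \ae lebesgue_rV R d, f x <= g x) -> forall x, f x <= g x.
Proof.
move=> cf cg [N [mN N0 fgN]] x; rewrite leNgt; apply/negP => gfx.
have : \forall y \near x, 0 < f y - g y.
  have fg : f y - g y @[y --> x] --> f x - g x.
    exact: (cvgB (cf x) (cg x)).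
  by apply: (cvgr_gt _ fg); rewrite subr_gt0.
move=> /nbhs_ballP[e /= e0 xe].
have := lebesgue_rV_ball_gt0 x e0; rewrite ltNge => /negP; apply.
rewrite -N0; apply: le_measure; rewrite ?inE//.
  by apply: open_measurable_rV; exact: ball_open.
by move=> y /xe; rewrite subr_gt0 => gfy; apply: fgN => /=; rewrite leNgt gfy.
Qed.

Lemma continuous_Lnorm_oo_le d (f : 'rV[R]_d -> R) C : continuous f ->
  ('N[lebesgue_rV R d]_+oo[EFin \o f] <= C%:E)%E -> forall x, `|f x| <= C.
Proof.
move=> cf; rewrite unlock /= lebesgue_rV_setT_gt0 => /ess_supP fC.
apply: (@continuous_ae_le _ (fun x => `|f x|) (fun=> C)).
- by move=> x; exact: (cvg_norm (cf x)).
- exact: cst_continuous.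
- by apply: filterS fC => x /=; rewrite lee_fin.
Qed.

(** The quotient minus the continuous representative [g] is continuous in [x], so its L^oo norm
    bounds it at every [x]. As [t] is positive, all nearby times are non-negative and the limit is
    two-sided. *)
Lemma Linfty_derivative_cvg d (u v : R -> 'rV[R]_d -> R) t (g : 'rV[R]_d -> R) :
  0 < t -> (forall s, 0 <= s -> continuous (u s)) -> continuous g ->
  v t = g %[ae lebesgue_rV R d] -> Linfty_derivative u v ->
  forall x, (s - t)^-1 * (u s x - u t x) @[s --> t^'] --> g x.
Proof.
move=> t0 cu cg vg du x; apply/cvgrPdist_le => e e0.
have /(_ (open_ereal_lt' _)) : _ := du t (ltW t0) [set y | (y < e%:E)%E].
rewrite /= lte_fin => /(_ e0) due.
have {}due : \forall s \near t^', 0 <= s -> ('N[lebesgue_rV R d]_+oo[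
    EFin \o (fun x => (s - t)^-1 * (u s x - u t x) - v t x)%R] < e%:E)%E by exact: due.
near=> s; have s0 : 0 <= s.
  by near: s; apply: nbhs_dnbhs; exact: (cvgr_ge _ cvg_id).
rewrite distrC; move: x; apply: continuous_Lnorm_oo_le.
  move=> x; have cut := cu t (ltW t0) x; have cus := cu s s0 x.
  exact: (cvgB (cvgM (cvg_cst _) (cvgB cus cut)) (cg x)).
(* Replacing [v t] by [g] alters the function on a null set only, hence not its essential
   supremum. *)
apply: le_trans (ltW (near due s _ s0)) => //.
rewrite unlock /= lebesgue_rV_setT_gt0; apply: le_ess_sup.
apply: filterS vg => x vgx /=; by rewrite vgx.
Unshelve. all: by end_near. Qed.

End lebesgue_rV_everywhere.

(** * Convexity, slopes and bounded representatives *)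

(** A convex graph lies above its tangents; adding the tangent inequalities at [a] and at [b]
    compares the two slopes. *)
Lemma convex_function_derive1_nondecreasing (R : realType) (eta : R -> R) :
  (forall s, derivable eta s 1) -> convex_function [set: R^o] eta ->
  nondecreasing (derive1 eta).
Proof.
move=> deta ceta.
have tangent a b : derive1 eta a * (b - a) <= eta b - eta a.
  have /derivable1_diffP da := deta a.
  have -> : derive1 eta a * (b - a) = 'D_(b - a) eta a.
    by rewrite deriveE// deriv1E// /= mulrC.
  have dv : derivable eta a (b - a) by exact: diff_derivable.
  have /cvg_dnbhs_at_right : h^-1 *: ((eta \o shift a) (h *: (b - a)) - eta a)
    @[h --> 0^'] --> 'D_(b - a) eta a by exact: dv.
  (* The limit is taken from the right, where [h] lies in [[0, 1]] and convexity bounds each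
     quotient by [eta b - eta a]. *)
  move=> /cvgr_to_le; apply; near=> h.
  have h0 : 0 < h by near: h; exact: nbhs_right_gt.
  have h1 : h <= 1 by near: h; exact: nbhs_right_le.
  have := ceta (Itv01 (ltW h0) h1) b a (in_setT _) (in_setT _).
  have -> : conv (Itv01 (ltW h0) h1) (b : convex_lmodType R^o) a = h *: (b - a) + a.
    rewrite /conv/= /unstable.onem /GRing.scale/=; ring.
  rewrite convRE /= /unstable.onem => ceh.
  rewrite /GRing.scale/= mulrC ler_pdivrMr// lerBlDr (le_trans ceh)//.
  lra.
move=> a b; rewrite le_eqVlt => /predU1P[->//|ab].
have := lerD (tangent a b) (tangent b a); rewrite addrA subrK subrr => ab0.
rewrite -subr_ge0 -(pmulr_lge0 _ (_ : 0 < b - a)) ?subr_gt0//.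
rewrite mulrBl; lra.
Unshelve. all: by end_near. Qed.

Lemma is_derive_slope_cvg (R : realType) (f : R -> R) t l :
  (s - t)^-1 * (f s - f t) @[s --> t^'] --> l -> is_derive t 1 f l.
Proof.
move=> fl; have shift0 : h + t @[h --> 0^'] --> t^'.
  move=> P [e /= e0 eP]; exists e => //= h; rewrite /ball_/= sub0r normrN => he h0.
  apply: eP; last by rewrite -subr_eq0 addrK.
  by rewrite /ball_/= opprD addrCA subrr addr0 normrN.
have dl : h^-1 *: ((f \o shift t) (h *: 1) - f t) @[h --> 0^'] --> l.
  have := cvg_comp _ _ shift0 fl; apply: cvg_trans; apply: near_eq_cvg.
  by apply: nearW => h /=; rewrite addrK [h *: 1]mulr1.
split; first by apply/cvg_ex; exists l.
exact: cvg_lim dl.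
Qed.

Lemma Lfun_oo_continuous_bounded (R : realType) d (f : 'rV[R]_d -> R) :
  f \in Lfun (lebesgue_rV R d) +oo%E -> continuous f ->
  exists M, forall x, `|f x| <= M.
Proof.
move=> /andP[_]; rewrite inE => Nf cf.
exists (fine ('N[lebesgue_rV R d]_+oo[EFin \o f])%E).
by apply: continuous_Lnorm_oo_le => //; rewrite fineK// ge0_fin_numE ?Lnorm_ge0.
Qed.

(** * The entropy inequality along the solution *)

Theorem lemma3p5 (R : realType) (d : nat) (d_ge1 : (1 <= d)%N)
  (F : R -> 'rV[R]_d) (F_lipschitz : lipschitz F) (F0 : F 0 = 0)
  (w : {measure set 'rV[R]_d -> \bar R})
  (w_finite : (w unit_sphere < +oo)%E)
  (w_isotropic : forall i j : 'I_d,
     \int[w]_(theta in unit_sphere)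
       (dotp theta (std_basis i) * dotp theta (std_basis j)) = (i == j)%:R)
  (Phi : filter_function R)
  (u0 : 'rV[R]_d -> R)
  (u0_Linfty : u0 \in Lfun (lebesgue_rV R d) +oo%E)
  (u0_lipschitz : lipschitz u0)
  (u : R -> 'rV[R]_d -> R)
  (u_solution : upwind_solution F w Phi u0 u)
  (u_lipschitz : forall t, 0 <= t -> lipschitz (u t))
  (eta : R -> R)
  (eta_derivable : forall s, derivable eta s 1)
  (eta_derivable2 : forall s, derivable (derive1 eta) s 1)
  (eta_C2 : continuous (derive1 (derive1 eta)))
  (eta_convex : convex_function [set: R^o] eta) :
  \forall z \ae (lebesgue_rV R d \x lebesgue_measure)%E,
    0 < z.2 ->
    derivable (fun t => eta (u t z.1)) z.2 1 /\
    derive1 (fun t => eta (u t z.1)) z.2 <=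
    filter_integral Phi w (fun y =>
      entropy_flux_plus F eta y (u z.2 z.1)
      - entropy_flux_plus F eta y (u z.2 (z.1 + y))
      + entropy_flux_minus F eta y (u z.2 z.1)
      - entropy_flux_minus F eta y (u z.2 (z.1 - y))).
Proof.
have [uL [[v [_ du _ v_eq]] _]] := u_solution.
have cu s : 0 <= s -> continuous (u s).
  by move=> /u_lipschitz /lipschitz_ex[k k0 us]; exact: lipschitz_continuous_ex us.
have ceta : continuous (derive1 eta).
  by move=> s; apply/differentiable_continuous/derivable1_diffP.
have ndeta := convex_function_derive1_nondecreasing eta_derivable eta_convex.
apply: aeW => -[x t] /= t0.
have [M uM] := Lfun_oo_continuous_bounded (uL t (ltW t0)) (cu t (ltW t0)).
have cW : continuous (upwind_divergence F Phi w (u t)).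
  by apply: upwind_divergence_continuous uM => //; exact: u_lipschitz (ltW t0).
(* The divergence is the continuous representative of [v t], so the equation holds at this very [x];
   the chain rule then reduces the claim to [upwind_divergence_entropy_le]. *)
have dut := @Linfty_derivative_cvg _ _ _ _ _ _ t0 cu cW (v_eq t t0) du x.
have is_du := is_derive_slope_cvg dut.
have is_deta : is_derive (u t x) 1 eta (derive1 eta (u t x)).
  by rewrite derive1E; exact: derivableP.
have [deu eu'] := is_derive1_comp is_deta is_du.
split; first exact: deu.
rewrite derive1E [leLHS]eu'.
exact: upwind_divergence_entropy_le (cu t (ltW t0)) uM.
Qed.
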